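(* Let $\mathcal{G}=(V_\mathcal{G},E^+_\mathcal{G},E^-_\mathcal{G},L_\mathcal{G})$ be a signed graph with $V_\mathcal{G}=[n]$. Then the following are equivalent: (i) every edge ordering of $\mathcal{G}$ is an even (respectively, odd) full cyclic permutation ordering; (ii) the unsigned multigraph $\bar{\mathcal{G}}$ is a tree and $|L_\mathcal{G}|$ is even (respectively, odd).
   Context: Let $n\ge1$, $[n]=\{1,\dots,n\}$, $I_n=\{-n,\dots,-1,1,\dots,n\}$. The hyperoctahedral group is $\mathfrak{H}_n=\{\eta\in\mathfrak{S}_{I_n}:\eta(-i)=-\eta(i)\ \forall i\in I_n\}$. Signed transpositions: for distinct $i,j\in[n]$, $(i\ j)$ swaps $i\leftrightarrow j$ (and $-i\leftrightarrow -j$), fixing everything else; $(i\ {-j})$ sends $i\mapsto -j$, $j\mapsto -i$ (and correspondingly on negatives), fixing everything else; for $i\in[n]$, the inversion transposition $(i\ {-i})$ sends $i\mapsto -i$ and fixes all other elements of $[n]$. An element $\eta\in\mathfrak{H}_n$ is an even (resp. odd) full cyclic permutation if there are an ordering $i_1,\dots,i_n$ of $[n]$ and signs $\epsilon_1,\dots,\epsilon_n\in\{+1,-1\}$ with $\eta(i_k)=\epsilon_k i_{k+1}$ for all $k$ (indices mod $n$) and $\epsilon_1\cdots\epsilon_n=+1$ (resp. $-1$). A signed graph is a quadruple $\mathcal{G}=(V_\mathcal{G},E^+_\mathcal{G},E^-_\mathcal{G},L_\mathcal{G})$ with $V_\mathcal{G}=[n]$, $E^+_\mathcal{G},E^-_\mathcal{G}$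 sets of 2-element subsets of $V_\mathcal{G}$ (positive and negative edges), and $L_\mathcal{G}\subseteq V_\mathcal{G}$ (loops); its edge set is the disjoint union $E_\mathcal{G}=E^+_\mathcal{G}\sqcup E^-_\mathcal{G}\sqcup L_\mathcal{G}$. To $e\in E_\mathcal{G}$ associate $\tau_e=(i\ j)$ if $e=\{i,j\}\in E^+_\mathcal{G}$, $\tau_e=(i\ {-j})$ if $e=\{i,j\}\in E^-_\mathcal{G}$, $\tau_e=(i\ {-i})$ if $e=i\in L_\mathcal{G}$. An edge ordering is a linear order $\omega=(e_1,\dots,e_m)$ of $E_\mathcal{G}$, and $\pi_\omega=\tau_{e_m}\cdots\tau_{e_1}\in\mathfrak{H}_n$. $\omega$ is an even (resp. odd) full cyclic permutation ordering if $\pi_\omega$ is an even (resp. odd) full cyclic permutation. $\bar{\mathcal{G}}$ denotes the unsigned multigraph on vertex set $[n]$ whose edge multiset is $E^+_\mathcal{G}\sqcup E^-_\mathcal{G}$ (so a pair lying in both $E^+_\mathcal{G}$ and $E^-_\mathcal{G}$ gives two parallel edges). *)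

(* Defs.v *)
From HB Require Import structures.
From mathcomp Require Import all_boot all_order all_fingroup all_algebra.

Set Implicit Arguments.
Unset Strict Implicit.
Unset Printing Implicit Defensive.

Import GroupScope.

(** The vertex set [n] is ['I_n] (0-based), and I_n = {-n,..,-1,1,..,n} is
    [bool * 'I_n]: [(false, i)] stands for i and [(true, i)] for -i. *)
Definition spoint (n : nat) : finType := (bool * 'I_n)%type.

Definition sopp (n : nat) (x : spoint n) : spoint n := (~~ x.1, x.2).

Definition hyperoct (n : nat) : {set {perm (spoint n)}} :=
  [set eta : {perm (spoint n)} | [forall x, eta (sopp x) == sopp (eta x)]].

(** [(i j)], [(i -j)] and [(i -i)]; the first two are meant for [i != j]. *)
Definition pos_transp (n : nat) (i j : 'I_n) : {perm (spoint n)} :=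
  tperm ((false, i) : spoint n) (false, j) *
  tperm ((true, i) : spoint n) (true, j).

Definition neg_transp (n : nat) (i j : 'I_n) : {perm (spoint n)} :=
  tperm ((false, i) : spoint n) (true, j) *
  tperm ((true, i) : spoint n) (false, j).

Definition inv_transp (n : nat) (i : 'I_n) : {perm (spoint n)} :=
  tperm ((false, i) : spoint n) (true, i).

(** The sign [eps k] is encoded by a boolean, [true] for -1; [ordS] is the
    cyclic successor on ['I_n]. *)
Definition full_cyclic (n : nat) (s : int) (eta : {perm (spoint n)}) : Prop :=
  eta \in hyperoct n /\
  exists (c : 'S_n) (eps : 'I_n -> bool),
    (forall k : 'I_n, eta (false, c k) = (eps k, c (ordS k))) /\
    (\prod_(k < n) (-1) ^+ (eps k) = s)%R.

Definition even_full_cyclic (n : nat) (eta : {perm (spoint n)}) : Prop :=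
  full_cyclic 1%R eta.

Definition odd_full_cyclic (n : nat) (eta : {perm (spoint n)}) : Prop :=
  full_cyclic (-1)%R eta.

Record sgraph (n : nat) := SGraph {
  pos_edges : {set {set 'I_n}};
  neg_edges : {set {set 'I_n}};
  loops : {set 'I_n};
  card_pos_edge : forall A, A \in pos_edges -> #|A| = 2;
  card_neg_edge : forall A, A \in neg_edges -> #|A| = 2
}.

(** [inl A] is the positive copy and [inr A] the negative copy of the pair A. *)
Definition pair_edge (n : nat) : finType := ({set 'I_n} + {set 'I_n})%type.

Definition sedge (n : nat) : finType := (pair_edge n + 'I_n)%type.

Definition pair_edges (n : nat) (G : sgraph n) : {set pair_edge n} :=
  [set e : pair_edge n | match e with
                         | inl A => A \in pos_edges G
                         | inr A => A \in neg_edges G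
                         end].

Definition sedges (n : nat) (G : sgraph n) : {set sedge n} :=
  [set e : sedge n | match e with
                     | inl p => p \in pair_edges G
                     | inr i => i \in loops G
                     end].

(** [on_pair f [set i; j]] is [f i j] for [i != j] and [f] symmetric; see
    [tau_pos] and [tau_neg]. *)
Definition on_pair (n : nat) (f : 'I_n -> 'I_n -> {perm (spoint n)})
    (A : {set 'I_n}) : {perm (spoint n)} :=
  if enum A is [:: i; j] then f i j else 1.

Definition tau (n : nat) (e : sedge n) : {perm (spoint n)} :=
  match e with
  | inl (inl A) => on_pair (@pos_transp n) A
  | inl (inr A) => on_pair (@neg_transp n) A
  | inr i => inv_transp i
  end.

Definition edge_ordering (n : nat) (G : sgraph n) (w : seq (sedge n)) : Prop :=
  uniq w /\ w =i sedges G.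

(** Products of permutations are read left to right in MathComp
    ([(s * t) x = t (s x)]), so this is tau_{e_m} o .. o tau_{e_1}. *)
Definition pi_ord (n : nat) (w : seq (sedge n)) : {perm (spoint n)} :=
  \prod_(e <- w) tau e.

Definition even_ordering (n : nat) (w : seq (sedge n)) : Prop :=
  even_full_cyclic (pi_ord w).

Definition odd_ordering (n : nat) (w : seq (sedge n)) : Prop :=
  odd_full_cyclic (pi_ord w).

(** Loopless multigraphs on V: distinct edges may have equal endpoint sets. *)
Record multigraph (V E : finType) := Multigraph {
  medges : {set E};
  mends : E -> {set V};
  card_mends : forall e, e \in medges -> #|mends e| = 2
}.

Definition madj (V E : finType) (M : multigraph V E) : rel V :=
  fun x y => [exists e in medges M, mends M e == [set x; y]].

Definition mconnected (V E : finType) (M : multigraph V E) : Prop :=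
  forall x y : V, connect (madj M) x y.

(** A cycle of length k >= 1: distinct vertices v_i and distinct edges e_i with
    e_i joining v_i to v_{i+1}, indices mod k. Two parallel edges form one. *)
Definition mcycle (V E : finType) (M : multigraph V E) (k : nat)
    (v : 'I_k -> V) (e : 'I_k -> E) : Prop :=
  [/\ 0 < k, injective v, injective e &
      forall i, e i \in medges M /\ mends M (e i) = [set v i; v (ordS i)]].

Definition macyclic (V E : finType) (M : multigraph V E) : Prop :=
  forall (k : nat) (v : 'I_k -> V) (e : 'I_k -> E), ~ mcycle M v e.

Definition is_tree (V E : finType) (M : multigraph V E) : Prop :=
  0 < #|V| /\ mconnected M /\ macyclic M.

Definition pair_ends (n : nat) (e : pair_edge n) : {set 'I_n} :=
  match e with inl A => A | inr A => A end.

Lemma card_pair_ends (n : nat) (G : sgraph n) (e : pair_edge n) :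
  e \in pair_edges G -> #|pair_ends e| = 2.
Proof.
by rewrite inE; case: e => A; [exact: card_pos_edge | exact: card_neg_edge].
Qed.

Definition unsigned (n : nat) (G : sgraph n) : multigraph 'I_n (pair_edge n) :=
  Multigraph (@card_pair_ends n G).

Lemma on_pairE (n : nat) (f : 'I_n -> 'I_n -> {perm (spoint n)}) (i j : 'I_n) :
  f i j = f j i -> i != j -> on_pair f [set i; j] = f i j.
Proof.
move=> fC neq_ij; rewrite /on_pair.
have: perm_eq (enum [set i; j]) [:: i; j].
  apply: uniq_perm; rewrite ?enum_uniq //= ?inE ?neq_ij //.
  by move=> x; rewrite mem_enum !inE.
case: (enum _) => [|a [|b [|c s]]] pe; try by move/perm_size: pe.
have := perm_uniq pe; rewrite /= !inE neq_ij andbT => neq_ab.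
have := perm_mem pe a; have := perm_mem pe b; rewrite !inE !eqxx orbT.
move=> /esym/orP[]/eqP Eb /esym/orP[]/eqP Ea; move: neq_ab; subst a b => //.
- by rewrite eqxx.
- by rewrite eqxx.
Qed.

Lemma pos_transpE (n : nat) (i j : 'I_n) (x : spoint n) :
  pos_transp i j x = (x.1, tperm i j x.2).
Proof.
case: x => b k; rewrite permM /=.
case: b; do !case: tpermP => //=; try congruence; move=> *; subst; congruence.
Qed.

Lemma neg_transpE (n : nat) (i j : 'I_n) (x : spoint n) : i != j ->
  neg_transp i j x =
    ((if x.2 \in [set i; j] then ~~ x.1 else x.1), tperm i j x.2).
Proof.
move=> neq_ij; have neq_ji : j == i = false by rewrite eq_sym (negPf neq_ij).
case: x => b k; rewrite /neg_transp permM /= !inE !permE /=.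
rewrite ?xpair_eqE; case: b => /=; case: (eqVneq k i) => [->|neq_ki] /=;
  rewrite ?xpair_eqE ?eqxx ?neq_ji ?(negPf neq_ij) ?(negPf neq_ki) /=;
  case: (eqVneq k j) => [Ekj|neq_kj] /=;
  by rewrite ?xpair_eqE ?eqxx ?Ekj ?neq_ji ?(negPf neq_ij) ?(negPf neq_ki)
             ?(negPf neq_kj) /= ?eqxx ?Ekj.
Qed.

Lemma inv_transpE (n : nat) (i : 'I_n) (x : spoint n) :
  inv_transp i x = ((if x.2 == i then ~~ x.1 else x.1), x.2).
Proof.
case: x => b k /=; rewrite /inv_transp.
case: tpermP => [[-> ->]|[-> ->]|]; rewrite ?eqxx //.
by case: eqP => // ->; case: b.
Qed.

Lemma tau_pos (n : nat) (i j : 'I_n) : i != j ->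
  tau (inl (inl [set i; j])) = pos_transp i j.
Proof.
move=> neq_ij; apply: on_pairE (neq_ij); apply/permP => x.
by rewrite !pos_transpE tpermC.
Qed.

Lemma tau_neg (n : nat) (i j : 'I_n) : i != j ->
  tau (inl (inr [set i; j])) = neg_transp i j.
Proof.
move=> neq_ij; apply: on_pairE (neq_ij); apply/permP => x.
have neq_ji : j != i by rewrite eq_sym.
by rewrite !neg_transpE // tpermC setUC.
Qed.

Lemma tau_hyperoct (n : nat) (G : sgraph n) (e : sedge n) :
  e \in sedges G -> tau e \in hyperoct n.
Proof.
rewrite inE => eG; rewrite inE; apply/forallP => x; apply/eqP.
case: e eG => [[A|A]|i] eG.
- have /eqP/cards2P[i [j [neq_ij EA]]] := card_pair_ends eG.
  by rewrite (EA : A = _) tau_pos // !pos_transpE.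
- have /eqP/cards2P[i [j [neq_ij EA]]] := card_pair_ends eG.
  rewrite (EA : A = _) tau_neg // !neg_transpE // /sopp /=.
  by case: ifP.
- by rewrite !inv_transpE /sopp /=; case: ifP.
Qed.

(* Main.v *)
Require Import Defs.
From mathcomp Require Import all_boot all_order all_fingroup all_algebra.

(**
Forgetting signs maps [pi_ord w] to the product of the transpositions of the
pair edges, and the number of signs of [pi_ord w] is always congruent to the
number of loops mod 2; so the question is when every ordering of the edges of
the underlying multigraph gives a permutation with a single orbit.

In a tree, each new edge joins two different orbits of the product of the
others and merges them. Conversely, orbits lie in connected components, so the
multigraph is connected. If it had a cycle with vertices v0, v1, .., v(k-1),
k >= 3, and edges ei from vi to v(i+1), let t be the product of e1, .., e(k-1)
followed by the remaining edges. Inserting e0 at the front, just after e1, and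
just after e(k-1), gives (v0 v1) t, (v0 v2) t and (v1 v2) t; all three have one
orbit only if t has exactly two orbits while v0, v1, v2 lie in three different
orbits, which is absurd. For
two parallel edges, placing them next to each other cancels them, so the other
edges still connect their ends; as there are at most two parallel edges, this
produces a cycle of length at least 3.
*)

Set Implicit Arguments.
Unset Strict Implicit.
Unset Printing Implicit Defensive.

Import GroupScope.

(** * Orbits of a permutation multiplied by a transposition *)

Section Orbits.
Variable V : finType.
Implicit Types (s t : {perm V}) (x y z : V) (A : {set V}).

Definition one_orbit s : Prop := forall x y, y \in porbit s x.

(** The default value 1 on sets that are not pairs makes products over arbitrary edge lists
    total. *)
Definition swap A : {perm V} := if enum A is [:: x; y] then tperm x y else 1.

Lemma swapE x y : x != y -> swap [set x; y] = tperm x y.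
Proof.
move=> neq_xy; rewrite /swap.
have: perm_eq (enum [set x; y]) [:: x; y].
  apply: uniq_perm; rewrite ?enum_uniq //= ?inE ?neq_xy //.
  by move=> z; rewrite mem_enum !inE.
case: (enum _) => [|a [|b [|c s]]] pe; try by move/perm_size: pe.
have := perm_uniq pe; rewrite /= !inE neq_xy andbT => neq_ab.
have := perm_mem pe a; have := perm_mem pe b; rewrite !inE !eqxx orbT.
move=> /esym/orP[]/eqP Eb /esym/orP[]/eqP Ea; move: neq_ab; subst a b => //.
- by rewrite eqxx.
- by rewrite tpermC.
- by rewrite eqxx.
Qed.

Lemma swapL x y : swap [set x; y] x = y.
Proof.
have [->|neq_xy] := eqVneq x y; last by rewrite swapE // tpermL.
by rewrite setUid /swap enum_set1 perm1.
Qed.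

Lemma swap_id A x : x \notin A -> swap A x = x.
Proof.
rewrite /swap => xA; case EA: (enum A) => [|a [|b [|c s]]]; rewrite ?perm1 //.
have inA z : (z \in A) = (z \in [:: a; b]) by rewrite -EA mem_enum.
by rewrite tpermD //; apply: contraNneq xA => <-; rewrite inA !inE eqxx ?orbT.
Qed.

(** The product sends [y] to [s x] and then follows [s] along the orbit of [x], which avoids [y],
    until it comes back to [x]. *)
Lemma porbit_mul_tpermL s x y :
  x \notin porbit s y -> {subset porbit s x <= porbit (tperm x y * s) y}.
Proof.
move=> nxy z /porbitP[i ->{z}].
suff H j : (s ^+ j.+1) x \in porbit (tperm x y * s) y.
  (* Only positive powers are reached from [y] directly; [x] itself is [(s ^+ #[s]) x]. *)
  case: i => [|i]; last exact: H.
  rewrite expg0 perm1; have := H #[s].-1.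
  by rewrite prednK ?order_gt0 // expg_order perm1.
elim: j => [|j IH].
  rewrite expg1 (_ : s x = ((tperm x y * s) ^+ 1) y) ?mem_porbit //.
  by rewrite expg1 permM tpermR.
have [Ex|nEx] := eqVneq ((s ^+ j.+1) x) x.
  rewrite expgSr permM Ex (_ : s x = ((tperm x y * s) ^+ 1) y) ?mem_porbit //.
  by rewrite expg1 permM tpermR.
have [Ey|nEy] := eqVneq ((s ^+ j.+1) x) y.
  by case/negP: nxy; rewrite -Ey porbit_sym mem_porbit.
rewrite (expgSr s j.+1) permM; set u := (s ^+ j.+1) x in nEx nEy IH *.
have -> : s u = ((tperm x y * s) ^+ 1) u by rewrite expg1 permM tpermD // eq_sym.
by rewrite porbit_sym porbit_perm -porbit_sym.
Qed.

(** The orbits of [x] and [y] merge, and [s] and the product agree on every other orbit. *)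
Lemma porbit_mul_tperm s x y : x \notin porbit s y ->
  (x \in porbit (tperm x y * s) y) /\
  forall z, {subset porbit s z <= porbit (tperm x y * s) z}.
Proof.
move=> nxy; have nyx : y \notin porbit s x by rewrite porbit_sym.
have Lx := porbit_mul_tpermL nxy.
have := porbit_mul_tpermL nyx; rewrite tpermC => Ly.
set t := tperm x y * s in Lx Ly *.
have xy : x \in porbit t y by apply: Lx; apply: porbit_id.
have Exy : porbit t x = porbit t y by apply/eqP; rewrite eq_porbit_mem.
split=> // z u zu.
have [xz|nxz] := boolP (z \in porbit s x).
  have Ez : porbit t z = porbit t y.
    by apply/eqP; rewrite eq_porbit_mem; apply: Lx.
  rewrite Ez; apply: Lx; move: xz; rewrite -eq_porbit_mem => /eqP <- //.
have [yz|nyz] := boolP (z \in porbit s y).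
  have Ez : porbit t z = porbit t x.
    by apply/eqP; rewrite eq_porbit_mem; apply: Ly.
  rewrite Ez; apply: Ly; move: yz; rewrite -eq_porbit_mem => /eqP <- //.
case/porbitP: zu => i ->{u}; suff -> : (s ^+ i) z = (t ^+ i) z by rewrite mem_porbit.
elim: i => [|i IH]; first by rewrite !expg0.
rewrite !expgSr !permM -IH tpermD //.
- by apply: contraNneq nxz => ->; rewrite porbit_sym mem_porbit.
- by apply: contraNneq nyz => ->; rewrite porbit_sym mem_porbit.
Qed.

Lemma one_orbit_card s x : one_orbit s -> #|porbits s| = 1%N.
Proof.
move=> tr; apply/eqP/cards1P; exists (porbit s x); apply/setP => B.
rewrite inE; apply/imsetP/eqP => [[y _ ->]|->]; last by exists x.
by apply/eqP; rewrite eq_porbit_mem.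
Qed.

(** A transposition splits one orbit or merges two; one orbit after a split would mean none
    before. *)
Lemma one_orbit_mul_tperm s x y : x != y -> one_orbit (tperm x y * s) ->
  x \notin porbit s y /\ #|porbits s| = 2.
Proof.
move=> neq_xy tr; have := porbits_mul_tperm s x y.
rewrite /= neq_xy (one_orbit_card x tr); case: (x \notin _) => /=.
  by rewrite addn1 => -[<-].
rewrite addn1 => -[/esym/eqP]; rewrite cards_eq0 => /eqP E.
have : porbit s x \in porbits s by apply: imset_f.
by rewrite E inE.
Qed.

(** Pigeonhole: [s] would have exactly two orbits, yet three points in pairwise different ones. *)
Lemma not_three_one_orbit s x y z : x != y -> x != z -> y != z ->
  one_orbit (tperm x y * s) -> one_orbit (tperm x z * s) ->
  ~ one_orbit (tperm y z * s).
Proof.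
move=> nxy nxz nyz /(one_orbit_mul_tperm nxy)[oxy c2].
move=> /(one_orbit_mul_tperm nxz)[oxz _] /(one_orbit_mul_tperm nyz)[oyz _].
have : [set porbit s x; porbit s y; porbit s z] \subset porbits s.
  by apply/subsetP => B; rewrite !inE => /orP[/orP[]|] /eqP ->; exact: imset_f.
move/subset_leq_card; rewrite c2 setUC cardsU1 cards2 !inE ?eq_porbit_mem.
by rewrite oxy negb_or porbit_sym oxz porbit_sym oyz.
Qed.
End Orbits.

(** * Products of edge transpositions, walks and cycles in edge lists *)

Section EdgeLists.
Variables (V E : finType) (ends : E -> {set V}).
Implicit Types (x y : V) (e : E) (w : seq E) (p : seq (V * E)).

Definition edge_prod w : {perm V} := \prod_(e <- w) swap (ends e).

Definition ladj w : rel V := fun x y => has (fun e => ends e == [set x; y]) w.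

(* A walk is stored as the list of its steps, each one the pair of the vertex
   reached and the edge taken. *)
Definition step : rel (V * E) := fun a b => ends b.2 == [set a.1; b.1].

Definition walk x p : bool :=
  if p is a :: p' then (ends a.2 == [set x; a.1]) && path step a p' else true.

(** The closing edge [e] is kept apart from the walk [p], so that it can be moved within an
    ordering. A one-step [p] gives a pair of parallel edges. *)
Definition lcycle w x p e : Prop :=
  [/\ walk x p, uniq (x :: unzip1 p), {subset unzip2 p <= w}, e \in w &
      e \notin unzip2 p /\ ends e = [set last x (unzip1 p); x]].

Lemma walk_cons x a p : walk x (a :: p) = (ends a.2 == [set x; a.1]) && walk a.1 p.
Proof. by case: p => //= b p; rewrite /step. Qed.

Lemma edge_prod_cons e w : edge_prod (e :: w) = swap (ends e) * edge_prod w.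
Proof. by rewrite /edge_prod big_cons. Qed.

Lemma edge_prod_cat w1 w2 : edge_prod (w1 ++ w2) = edge_prod w1 * edge_prod w2.
Proof. by rewrite /edge_prod big_cat. Qed.

(** Read from left to right, each transposition carries the moving point one step along the walk. *)
Lemma edge_prod_walk x p : walk x p -> edge_prod (unzip2 p) x = last x (unzip1 p).
Proof.
elim: p x => [|a p IH] x; first by rewrite /edge_prod big_nil perm1.
rewrite walk_cons => /andP[/eqP Ea /IH {}IH].
by rewrite /= edge_prod_cons permM Ea swapL.
Qed.

Lemma walk_nth y e x p i : walk x p -> i < size p ->
  ends (nth e (unzip2 p) i) = [set nth y (x :: unzip1 p) i; nth y (unzip1 p) i].
Proof.
elim: p x i => [|a p IH] x [|i] //; rewrite walk_cons => /andP[/eqP Ea Wp] //.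
by rewrite ltnS => /(IH _ _ Wp) /= ->.
Qed.

Lemma walk_ends x y p : walk x p -> y \notin x :: unzip1 p ->
  {in unzip2 p, forall e, y \notin ends e}.
Proof.
elim: p x => [|a p IH] x // ; rewrite walk_cons => /andP[/eqP Ea Wp].
rewrite /= !inE !negb_or => /and3P[nyx nya nyp] e.
rewrite inE => /predU1P[->|ep]; last by apply: (IH _ Wp) => //; rewrite inE negb_or nya.
by rewrite Ea !inE negb_or nyx.
Qed.

Lemma edge_prod_fix x w : {in w, forall e, x \notin ends e} -> edge_prod w x = x.
Proof.
elim: w => [|e w IH] nx; first by rewrite /edge_prod big_nil perm1.
rewrite edge_prod_cons permM swap_id ?nx ?mem_head // IH // => f fw.
by apply: nx; rewrite inE fw orbT.
Qed.

(** The first edge contains [x], which no later edge touches. *)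
Lemma walk_uniq_edges x p : walk x p -> uniq (x :: unzip1 p) -> uniq (unzip2 p).
Proof.
elim: p x => [|a p IH] x //; rewrite walk_cons => /andP[/eqP Ea Wp].
rewrite [uniq _]/= => /andP[nx Up]; rewrite /= (IH a.1) // andbT.
by apply/negP => /(walk_ends Wp nx); rewrite Ea !inE eqxx.
Qed.

Lemma ladj_walk w x q : path (ladj w) x q ->
  exists p, [/\ unzip1 p = q, walk x p & {subset unzip2 p <= w}].
Proof.
elim: q x => [|y q IH] x /=; first by exists [::].
case/andP=> /hasP[e ew Ee] /IH[p [Eq Wp sp]]; exists ((y, e) :: p); split.
- by rewrite /= Eq.
- by rewrite walk_cons Ee.
- by move=> f; rewrite /= inE => /predU1P[->|/sp].
Qed.

Lemma connect_walk w x y : connect (ladj w) x y ->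
  exists p, [/\ walk x p, uniq (x :: unzip1 p), {subset unzip2 p <= w}
             & y = last x (unzip1 p)].
Proof.
case/connectP=> q Pq ->; case: (shortenP Pq) => q' Pq' Uq' _.
by have [p [Eq Wp sp]] := ladj_walk Pq'; exists p; rewrite Eq.
Qed.

Lemma connect_edge_prod w x : {in w, forall e, #|ends e| = 2} ->
  connect (ladj w) x (edge_prod w x).
Proof.
elim: w x => [|e w IH] x c2; first by rewrite /edge_prod big_nil perm1.
rewrite edge_prod_cons permM.
apply: (@connect_trans _ _ (swap (ends e) x)); last first.
  apply: connect_sub (IH _ _) => [a b ab|f fw]; last by apply: c2; rewrite inE fw orbT.
  by apply: connect1; rewrite /ladj /=; apply/orP; right.
have [xe|nxe] := boolP (x \in ends e); last by rewrite swap_id.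
have /eqP/cards2P[a [b [nab Ee]]] := c2 e (mem_head _ _).
apply: connect1; rewrite /ladj /= Ee; apply/orP; left.
move: xe; rewrite Ee !inE => /orP[]/eqP->; first by rewrite swapL.
by rewrite [X in swap X]setUC swapL setUC.
Qed.

Lemma connect_porbit w x y : {in w, forall e, #|ends e| = 2} ->
  y \in porbit (edge_prod w) x -> connect (ladj w) x y.
Proof.
move=> c2 /porbitP[i ->{y}]; elim: i => [|i IH]; first by rewrite expg0 perm1.
by rewrite expgSr permM; apply: connect_trans IH (connect_edge_prod _ c2).
Qed.

(** Induction on the list: the first edge joins two orbits of the product of the others, and its
    transposition merges them. *)
Lemma acyclic_porbit w x y : uniq w -> {in w, forall e, #|ends e| = 2} ->
  (forall z p e, ~ lcycle w z p e) ->
  connect (ladj w) x y -> y \in porbit (edge_prod w) x.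
Proof.
elim: w x y => [|e w IH] x y.
  move=> _ _ _ /connectP[[|z p] //= _ ->]; exact: porbit_id.
rewrite [uniq _]/= => /andP[new Uw] c2 ac.
have sw : {subset w <= e :: w} by move=> f fw; rewrite inE fw orbT.
have c2w : {in w, forall f, #|ends f| = 2} by move=> f /sw; apply: c2.
have {}IH a b : connect (ladj w) a b -> b \in porbit (edge_prod w) a.
  apply: IH => // z p f [Wp Up sp fw [nf Ef]]; apply: (ac z p f); split=> //.
    by move=> g /sp/sw.
  exact: sw.
have /eqP/cards2P[a [b [nab Ee]]] := c2 e (mem_head _ _).
(* Otherwise a simple walk in [w] between the ends of [e], closed by [e], would be a cycle. *)
have nabw : a \notin porbit (edge_prod w) b.
  apply/negP => /(connect_porbit c2w)/connect_walk[p [Wp Up sp Ea]].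
  apply: (ac b p e); split=> //; first by move=> f /sp/sw.
    exact: mem_head.
  split; last by rewrite -Ea Ee.
  by apply: contra new => /sp.
have [abt mono] := porbit_mul_tperm nabw.
rewrite edge_prod_cons Ee swapE //; set t := _ * _ in abt mono *.
(* Each step of the path stays in one orbit of [t]: either it uses an edge of [w], or it uses [e]
   and joins [a] and [b]. *)
case/connectP=> q Pq ->{y}; elim: q x Pq => [|z q IHq] x /=; first by rewrite porbit_id.
case/andP=> xz /IHq; suff : z \in porbit t x.
  by rewrite -eq_porbit_mem => /eqP ->.
move: xz; rewrite /ladj /= => /orP[/eqP Exz|xz]; last first.
  by apply: mono; apply: IH; apply: connect1.
have : a \in [set x; z] by rewrite -Exz Ee !inE eqxx.
have : b \in [set x; z] by rewrite -Exz Ee !inE eqxx orbT.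
rewrite !inE => /orP[]/eqP Eb /orP[]/eqP Ea; move: abt nab; rewrite Ea Eb ?eqxx //.
by rewrite porbit_sym.
Qed.

(* For a cycle x = v1, v2, .., vk = v0 with closing edge e, the three
   products below are (v0 v1) t, (v0 v2) t and (v1 v2) t for one and the same t. *)
Lemma long_lcycle_ordering x a b p e r :
    walk x [:: a, b & p] -> uniq (x :: unzip1 [:: a, b & p]) ->
    ends e = [set last x (unzip1 [:: a, b & p]); x] ->
    let q := unzip2 (b :: p) in
    one_orbit (edge_prod ([:: e, a.2 & q] ++ r)) ->
    one_orbit (edge_prod ([:: a.2, e & q] ++ r)) ->
  ~ one_orbit (edge_prod ((a.2 :: rcons q e) ++ r)).
Proof.
move=> W U Ee q.
set y := last _ _ in Ee.
have W' := W; rewrite walk_cons in W; case/andP: W => /eqP Ea W.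
have Ua : uniq (a.1 :: unzip1 (b :: p)) by case/andP: U.
have nx : x \notin a.1 :: unzip1 (b :: p) by case/andP: U.
have yb : y \in unzip1 (b :: p) by rewrite /y /= mem_last.
have nya : y != a.1 by apply: contraTneq yb => ->; case/andP: Ua.
have nxa : x != a.1 by apply: contraNneq nx => ->; rewrite mem_head.
have nyx : y != x by apply: contraNneq nx => <-; rewrite inE yb orbT.
(* The next four facts give the preimages of the ends [y] and [x] of [e]: [y] and [a.1] under the
   first edge, [x] and [a.1] under the whole walk. *)
have Qx : edge_prod (a.2 :: q) x = y := edge_prod_walk W'.
have Sa : swap (ends a.2) a.1 = x by rewrite Ea setUC swapL.
have Qa : edge_prod (a.2 :: q) a.1 = x.
  by rewrite edge_prod_cons permM Sa edge_prod_fix //; apply: walk_ends W nx.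
have Sy : swap (ends a.2) y = y.
  by rewrite swap_id // Ea !inE negb_or nyx nya.
set t := edge_prod (a.2 :: q ++ r).
(* Moving a transposition to the left of [u] conjugates it, so its points become their preimages
   under [u]. *)
have mv (u s : {perm V}) c d c' d' : u c = c' -> u d = d' ->
    u * (tperm c' d' * s) = tperm c d * (u * s).
  by move=> <- <-; rewrite mulgA -tpermJ -conjgC mulgA.
have E0 : edge_prod ([:: e, a.2 & q] ++ r) = tperm y x * t.
  by rewrite /= edge_prod_cons Ee swapE.
have E1 : edge_prod ([:: a.2, e & q] ++ r) = tperm y a.1 * t.
  by rewrite /t /= !edge_prod_cons Ee swapE // (mv _ _ y a.1).
have E2 : edge_prod ((a.2 :: rcons q e) ++ r) = tperm x a.1 * t.
  rewrite -rcons_cons cat_rcons edge_prod_cat (edge_prod_cons e) Ee swapE //.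
  by rewrite (mv _ _ x a.1) // -edge_prod_cat.
by rewrite E0 E1 E2; apply: not_three_one_orbit.
Qed.

(** A longer cycle would admit the three placements of [e], each followed by the same list of
    remaining edges, hence three rearrangements of [w]. *)
Lemma one_orbit_long_lcycle w x p e : uniq w ->
    (forall w', perm_eq w' w -> one_orbit (edge_prod w')) ->
  lcycle w x p e -> size p <= 1.
Proof.
move=> Uw all1 [Wp Up sp ew [nep Ee]]; rewrite leqNgt; apply/negP.
case: p Wp Up sp nep Ee => [|a [|b p]] // Wp Up sp nep Ee _.
pose c := e :: unzip2 [:: a, b & p].
have Uc : uniq c by rewrite /c cons_uniq nep (walk_uniq_edges Wp Up).
pose r := [seq f <- w | f \notin c].
have pc : perm_eq (c ++ r) w.
  apply: uniq_perm => //.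
    rewrite cat_uniq Uc filter_uniq // andbT; apply/hasPn => f.
    by rewrite mem_filter => /andP[].
  move=> f; rewrite mem_cat mem_filter.
  have [fc|] //= := boolP (f \in c).
  by case/predU1P: fc => [->|/sp ->] //; apply/esym.
have pe w' : perm_eq w' c -> one_orbit (edge_prod (w' ++ r)).
  by move=> pw; apply: all1; apply: perm_trans pc; rewrite perm_cat2r.
apply: (long_lcycle_ordering (r := r) Wp Up Ee); apply: pe => //.
  exact: (permEl (perm_catCA [:: a.2] [:: e] _)).
by rewrite -rcons_cons perm_rcons.
Qed.

(** Long cycles being excluded, only a parallel pair remains. The hypothesis on triples allows at
    most two edges with the same ends. *)
Lemma one_orbit_acyclic w : uniq w -> {in w, forall e, #|ends e| = 2} ->
    (forall e f g, e \in w -> f \in w -> g \in w -> e != f ->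
       ends e = ends f -> ends g = ends e -> g \in [:: e; f]) ->
    (forall w', perm_eq w' w -> one_orbit (edge_prod w')) ->
  forall x p e, ~ lcycle w x p e.
Proof.
move=> Uw c2 par all1 x p e cyc.
have := one_orbit_long_lcycle Uw all1 cyc.
case: p cyc => [|a [|b p]] // [Wp Up sp ew [nep Ee]] _.
  by have := c2 e ew; rewrite Ee setUid cards1.
have {Wp} /eqP Ea : ends a.2 == [set x; a.1] by move: Wp; rewrite walk_cons => /andP[].
have aw : a.2 \in w by apply: sp; rewrite mem_head.
have nea : e != a.2 by move: nep; rewrite inE.
have nxa : x != a.1 by move: Up; rewrite /= inE andbT.
have {}Ee : ends e = ends a.2 by rewrite Ee /= setUC Ea.
pose r := [seq f <- w | f \notin [:: e; a.2]].
have pc : perm_eq ([:: e; a.2] ++ r) w.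
  apply: uniq_perm => //.
    rewrite cat_uniq filter_uniq // andbT cons_uniq inE nea; apply/hasPn => f.
    by rewrite mem_filter => /andP[].
  move=> f; rewrite mem_cat mem_filter.
  have [fc|] //= := boolP (f \in [:: e; a.2]).
  by move: fc; rewrite !inE => /orP[]/eqP ->; rewrite ?ew ?aw.
have sr : {subset r <= w} by move=> f; rewrite mem_filter => /andP[].
(* The parallel edges, placed first, cancel, so the product over [r] alone has one orbit. *)
have := all1 _ pc x a.1; rewrite /= !edge_prod_cons Ee mulgA Ea swapE // tperm2 mul1g.
have c2r : {in r, forall f, #|ends f| = 2} by move=> f /sr; apply: c2.
case/(connect_porbit c2r)/connect_walk=> q [Wq Uq sq Eq].
have cyc : lcycle w x q e.
  split=> //; first by move=> f /sq/sr.
  split; last by rewrite -Eq setUC Ee.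
  by apply/negP => /sq; rewrite mem_filter inE eqxx.
have := one_orbit_long_lcycle Uw all1 cyc.
(* The new walk is not empty since its ends differ, and a single step would be a third parallel
   edge. *)
case: q Wq Uq sq Eq {cyc} => [|b [|d q]] //= Wq Uq sq Eq _.
  by rewrite Eq eqxx in nxa.
move: Wq; rewrite andbT => /eqP Eb.
have br : b.2 \in r by apply: sq; rewrite mem_head.
have := par e a.2 b.2 ew aw (sr _ br) nea Ee.
rewrite Eb -Eq Ee Ea => /(_ erefl).
by move: br; rewrite mem_filter => /andP[/negPf ->].
Qed.

End EdgeLists.

(** * From edge lists to multigraphs and trees *)

Section Multigraphs.
Variables (V E : finType) (M : multigraph V E).
Implicit Types (w : seq E).

Lemma madj_ladj w : w =i medges M -> madj M =2 ladj (mends M) w.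
Proof.
move=> Ew x y; apply/existsP/hasP => [[e /andP[eM Ee]]|[e ew Ee]].
  by exists e; rewrite ?Ew.
by exists e; rewrite -Ew ew.
Qed.

Lemma lcycle_mcycle w x p e : w =i medges M -> lcycle (mends M) w x p e ->
  exists k (v : 'I_k -> V) (f : 'I_k -> E), mcycle M v f.
Proof.
move=> Ew [Wp Up sp ew [nep Ee]].
pose vs := x :: unzip1 p; pose es := rcons (unzip2 p) e.
have szv : size vs = (size p).+1 by rewrite /= size_map.
have sze : size es = (size p).+1 by rewrite size_rcons size_map.
exists (size p).+1, (fun i => nth x vs i), (fun i => nth e es i); split=> //.
- by move=> i j /eqP; rewrite nth_uniq ?szv // => /eqP/val_inj.
- move=> i j /eqP; rewrite nth_uniq ?sze ?rcons_uniq ?nep ?(walk_uniq_edges Wp Up) //.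
  by move/eqP/val_inj.
- move=> i; split.
    rewrite -Ew; have : nth e es i \in es by rewrite mem_nth // sze.
    by rewrite mem_rcons inE => /predU1P[->|/sp].
  (* The last index carries the closing edge, where [ordS] wraps around to 0. *)
  have [->|ni] := eqVneq i ord_max.
    rewrite /= modnn nth_rcons size_map ltnn eqxx Ee.
    by rewrite /vs -(size_map fst p) nth_last.
  have lti : i < size p.
    rewrite ltn_neqAle -ltnS ltn_ord andbT.
    by apply: contra ni => /eqP Ei; apply/eqP/val_inj.
  rewrite /= modn_small ?ltnS // nth_rcons size_map lti.
  by rewrite (walk_nth x _ Wp).
Qed.

Lemma mcycle_lcycle w k (v : 'I_k -> V) (f : 'I_k -> E) : w =i medges M ->
  mcycle M v f -> exists x p e, lcycle (mends M) w x p e.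
Proof.
case: k v f => [|m] v f Ew [] // _ vI fI H.
(* Extending the families to all naturals by [inord] allows lists over [iota]; only indices up to
   [m] matter. *)
pose v' i := v (inord i : 'I_m.+1); pose f' i := f (inord i : 'I_m.+1).
have inordI : {in iota 0 m.+1 &, injective (fun i => inord i : 'I_m.+1)}.
  move=> i j; rewrite !mem_iota => /= lti ltj /(congr1 (@nat_of_ord _)).
  by rewrite !inordK.
have Uv : uniq (map v' (iota 0 m.+1)).
  by rewrite map_inj_in_uniq ?iota_uniq // => i j ii ij /vI/inordI->.
have Uf : uniq (map f' (iota 0 m.+1)).
  by rewrite map_inj_in_uniq ?iota_uniq // => i j ii ij /fI/inordI->.
have fw i : f' i \in w by rewrite Ew; case: (H (inord i)).
pose p := [seq (v' i.+1, f' i) | i <- iota 0 m].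
have E1 : v' 0 :: unzip1 p = map v' (iota 0 m.+1).
  rewrite /= (iotaDl 1%N 0) /unzip1 -!map_comp; congr cons; apply: eq_map.
have E2 : rcons (unzip2 p) (f' m) = map f' (iota 0 m.+1).
  by rewrite -[in RHS](addn1 m) iotaD map_cat cats1 /unzip2 -map_comp.
exists (v' 0), p, (f' m); split=> //.
- suff W d j : d + j <= m ->
      walk (mends M) (v' j) [seq (v' i.+1, f' i) | i <- iota j d].
    by apply: W; rewrite addn0.
  elim: d j => [|d IH] j // ledm.
  rewrite [iota _ _]/= map_cons walk_cons IH; last by rewrite addnS.
  have [_ ->] := H (inord j); rewrite andbT /=.
  apply/eqP; congr [set _; v _]; apply: val_inj => /=.
  have ltjm : j < m by apply: leq_trans ledm; rewrite addSn ltnS leq_addl.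
  by rewrite !inordK ?modn_small // ltnS // ltnW.
- by rewrite E1.
- by move=> e /mapP[a /mapP[i _ ->] ->]; apply: fw.
split; first by move: Uf; rewrite -E2 rcons_uniq => /andP[].
have [_ ->] := H (inord m).
have -> : last (v' 0) (unzip1 p) = v' m.
  rewrite -[last _ _]/(last (v' 0) (v' 0 :: unzip1 p)) E1.
  by rewrite -[in LHS](addn1 m) iotaD map_cat last_cat.
congr [set _; v _]; apply: val_inj; rewrite /= !inordK //.
exact: modnn.
Qed.

Lemma one_orbit_tree : 0 < #|V| ->
    (forall e f g, e \in medges M -> f \in medges M -> g \in medges M ->
       e != f -> mends M e = mends M f -> mends M g = mends M e ->
       g \in [:: e; f]) ->
  (forall w, uniq w -> w =i medges M -> one_orbit (edge_prod (mends M) w)) <->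
  is_tree M.
Proof.
move=> V0 par; split=> [all1|[_ [conn acyc]] w Uw Ew x y]; last first.
  apply: acyclic_porbit => //.
  - by move=> e ew; apply: card_mends; rewrite -Ew.
  - by move=> z p e /(lcycle_mcycle Ew)[k [v [f /acyc]]].
  - by rewrite -(eq_connect (madj_ladj Ew)).
pose w := enum (medges M).
have Uw : uniq w by apply: enum_uniq.
have Ew : w =i medges M by move=> e; rewrite mem_enum.
have c2 : {in w, forall e, #|mends M e| = 2}.
  by move=> e; rewrite Ew; apply: card_mends.
split=> //; split=> [x y|k v f].
  by rewrite (eq_connect (madj_ladj Ew)); apply: connect_porbit => //; apply: all1.
case/(mcycle_lcycle Ew)=> x [p [e]]; apply: one_orbit_acyclic => //.
  by move=> e1 e2 e3; rewrite !Ew; apply: par.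
move=> w' pw; apply: all1; first by rewrite (perm_uniq pw).
by move=> a; rewrite (perm_mem pw).
Qed.

End Multigraphs.

(** * Signed permutations: underlying permutation and parity of signs *)

Section Signs.
Variable n : nat.
Implicit Types (P : {perm 'I_n}) (eta : {perm (spoint n)}) (f : 'I_n -> bool).

Lemma prod_sign f (P : {perm 'I_n}) :
  (\prod_(k < n) (-1) ^+ (f (P k)) = (-1) ^+ (\big[addb/false]_k f k) :> int)%R.
Proof.
rewrite (big_morph (fun b : bool => ((-1) ^+ b : int)%R)
  (id1 := 1%R) (op1 := *%R) (@GRing.signr_addb _)) //.
by rewrite [RHS](reindex_inj (@perm_inj _ P)).
Qed.

(** The cyclic ordering is given by the iterates of [P] at a base point, which are distinct for
    exponents below the orbit length [n]. *)
Lemma one_orbit_cycle (n0 : 0 < n) P : one_orbit P <->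
  exists c : 'S_n, forall k, P (c k) = c (ordS k).
Proof.
case: n n0 P => [|m] // _ P; split=> [tr|[c Ec] x y]; last first.
  have H j : j < m.+1 -> (P ^+ j) (c ord0) = c (inord j).
    elim: j => [|j IH] ltj.
      by rewrite expg0 perm1; congr (c _); apply: val_inj; rewrite /= inordK.
    rewrite expgSr permM IH ?(ltnW ltj) // Ec; congr (c _); apply: val_inj.
    by rewrite /= !inordK ?(ltnW ltj) // modn_small.
  have in0 z : z \in porbit P (c ord0).
    rewrite -(permKV c z); set k := c^-1 z.
    by rewrite -(inord_val k) -H // mem_porbit.
  by have := in0 x; rewrite -eq_porbit_mem => /eqP ->.
pose x : 'I_m.+1 := ord0.
have sz : #|porbit P x| = m.+1.
  rewrite -[RHS](card_ord m.+1) -cardsT; congr #|pred_of_set _|.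
  by apply/setP => y; rewrite !inE tr.
have cI : injective (fun k : 'I_m.+1 => (P ^+ k) x).
  move=> i j /eqP; have := uniq_traject_porbit P x; rewrite sz => U.
  rewrite !permX -!(@nth_traject _ P _ m.+1) ?nth_uniq ?size_traject //.
  by move/eqP/val_inj.
exists (perm cI) => k; rewrite !permE -permM -expgSr /=.
have [ltk|] := ltnP k.+1 m.+1; first by rewrite modn_small.
move=> lek; have -> : k.+1 = m.+1 by apply/eqP; rewrite eqn_leq lek ltn_ord.
by rewrite modnn expg0 perm1 permX; have := iter_porbit P x; rewrite sz.
Qed.

(** The signs along the cyclic ordering [c] are [f \o c], so their product does not depend on
    [c]. *)
Lemma full_cyclic_one_orbit (n0 : 0 < n) (s : int) eta P f :
    (forall b i, eta (b, i) = (b (+) f i, P i)) ->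
  full_cyclic s eta <->
  one_orbit P /\ ((-1) ^+ (\big[addb/false]_i f i))%R = s.
Proof.
move=> Eeta; split=> [[_ [c [eps [Ec <-]]]]|[/(one_orbit_cycle n0)[c Ec] <-]].
  have Ef k : eps k = f (c k) /\ P (c k) = c (ordS k).
    by have := Ec k; rewrite Eeta => -[-> ->].
  split; first by apply/one_orbit_cycle => //; exists c => k; case: (Ef k).
  by rewrite -(prod_sign f c); apply: eq_bigr => k _; have [-> _] := Ef k.
split.
  rewrite inE; apply/forallP => -[b i].
  by rewrite /sopp /= !Eeta /= addNb.
by exists c, (f \o c); split=> [k|]; rewrite ?Eeta ?Ec // -(prod_sign f c).
Qed.

Definition pair_part (e : sedge n) : option (pair_edge n) :=
  if e is inl p then Some p else None.

Definition edge_perm (e : sedge n) : {perm 'I_n} :=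
  if e is inl p then swap (pair_ends p) else 1.

Lemma prod_edge_perm (w : seq (sedge n)) :
  \prod_(e <- w) edge_perm e = edge_prod (@pair_ends n) (pmap pair_part w).
Proof.
elim: w => [|[p|i] w IH]; first by rewrite /edge_prod !big_nil.
  by rewrite big_cons IH /= edge_prod_cons.
by rewrite big_cons IH /= mul1g.
Qed.

(** A positive edge changes no sign, a negative edge two and a loop one, so the parity detects
    loops. *)
Lemma tau_signed (G : sgraph n) (e : sedge n) : e \in sedges G ->
  exists2 f, forall b i, tau e (b, i) = (b (+) f i, edge_perm e i)
           & \big[addb/false]_i f i = ~~ pair_part e.
Proof.
have sum1 (i : 'I_n) : \big[addb/false]_k (k == i) = true.
  by rewrite (bigD1 i) //= eqxx big1 // => k /negPf.
rewrite inE; case: e => [[A|A]|i] eG /=.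
- have /eqP/cards2P[i [j [nij EA]]] := card_pair_ends eG.
  rewrite /= in EA; exists (fun=> false); last by rewrite big1.
  by move=> b k; rewrite -/(tau (inl (inl A))) EA tau_pos // swapE // pos_transpE addbF.
- have /eqP/cards2P[i [j [nij EA]]] := card_pair_ends eG.
  rewrite /= in EA; exists (fun k => (k == i) (+) (k == j)).
    move=> b k; rewrite -/(tau (inl (inr A))) EA tau_neg // swapE //.
    rewrite neg_transpE // !inE /=.
    have [->|_] := eqVneq k i; first by rewrite (negPf nij) addbT.
    by case: (k == j); rewrite ?addbT ?addbF.
  by rewrite big_split /= !sum1.
- exists (fun k => k == i) => // b k.
  by rewrite inv_transpE perm1 /=; case: eqP; rewrite ?addbT ?addbF.
Qed.

(** Signs add up along the composition; reindexing by the permutation of each factor makes the total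
    parity additive. *)
Lemma pi_ord_signed (G : sgraph n) (w : seq (sedge n)) :
    {subset w <= sedges G} ->
  exists2 f, forall b i, pi_ord w (b, i)
               = (b (+) f i, edge_prod (@pair_ends n) (pmap pair_part w) i)
           & \big[addb/false]_i f i = odd (count (fun e => ~~ pair_part e) w).
Proof.
rewrite -prod_edge_perm /pi_ord; elim: w => [|e w IH] sw.
  by exists (fun=> false) => [b i|]; rewrite ?big_nil ?perm1 ?addbF // big1.
have [|f Ef sf] := IH; first by move=> a aw; apply: sw; rewrite inE aw orbT.
have [g Eg sg] := tau_signed (sw e (mem_head _ _)).
exists (fun i => g i (+) f (edge_perm e i)) => [b i|].
  by rewrite !big_cons !permM Eg Ef addbA.
rewrite big_split /= sg oddD oddb -sf; congr (_ (+) _).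
by rewrite [RHS](reindex_inj (@perm_inj _ (edge_perm e))).
Qed.

End Signs.

(** * Orderings of a signed graph and of its underlying multigraph *)

Section SignedGraphs.
Variables (n : nat) (G : sgraph n).

Lemma edge_ordering_loops (w : seq (sedge n)) : edge_ordering G w ->
  count (fun e => ~~ pair_part e) w = #|loops G|.
Proof.
case=> Uw Ew; rewrite -size_filter cardE -(size_map (@inr (pair_edge n) 'I_n)).
apply: perm_size; apply: uniq_perm; rewrite ?filter_uniq //.
  by rewrite map_inj_uniq ?enum_uniq // => i j [].
move=> e; rewrite mem_filter Ew inE.
case: e => [p|i] /=; first by apply/esym/mapP => -[].
by rewrite mem_map ?mem_enum // => a b [].
Qed.

Lemma edge_ordering_pairs (w : seq (sedge n)) : edge_ordering G w ->
  uniq (pmap (@pair_part n) w) /\ pmap (@pair_part n) w =i medges (unsigned G).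
Proof.
case=> Uw Ew; have K : ocancel (@pair_part n) (@inl (pair_edge n) 'I_n) by case.
split; first exact: pmap_uniq K _ Uw.
move=> p; rewrite (can2_mem_pmap K) //.
  by rewrite Ew inE.
Qed.

(** Appending the loops extends any ordering of the pair edges, so a statement on all orderings of
    [G] reaches all those of the multigraph. *)
Lemma edge_ordering_of_pairs (w : seq (pair_edge n)) :
    uniq w -> w =i medges (unsigned G) ->
  exists2 w', edge_ordering G w' & pmap (@pair_part n) w' = w.
Proof.
move=> Uw Ew; exists (map inl w ++ map inr (enum (loops G))).
  split.
    rewrite cat_uniq !map_inj_uniq ?enum_uniq // ?Uw ?andbT /=; try by move=> a b [].
    by apply/hasPn => e /mapP[i _ ->]; apply/mapP => -[].
  move=> [p|i]; rewrite mem_cat inE.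
    rewrite mem_map ?Ew //; last by move=> a b [].
    by case: (p \in _) => //=; apply/mapP => -[].
  rewrite mem_map ?mem_enum; last by move=> a b [].
  by case: (i \in _); rewrite ?orbT ?orbF //; apply/mapP => -[].
rewrite pmap_cat; set s := enum _.
have -> : pmap (@pair_part n) (map inr s) = [::] by elim: s.
by rewrite cats0 map_pK.
Qed.

(** A pair has only a positive and a negative copy. *)
Lemma unsigned_parallel e f g : e != f ->
  mends (unsigned G) e = mends (unsigned G) f ->
  mends (unsigned G) g = mends (unsigned G) e -> g \in [:: e; f].
Proof.
move=> + + Eg; move: Eg; case: e => A; case: f => B; case: g => C /=;
  by move=> -> + E; rewrite E !inE eqxx ?orbT.
Qed.

Lemma full_cyclic_orderings (n0 : 0 < n) (s : int) :
  (forall w, edge_ordering G w -> full_cyclic s (pi_ord w)) <->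
  is_tree (unsigned G) /\ ((-1) ^+ (odd #|loops G|))%R = s.
Proof.
have key w : edge_ordering G w -> full_cyclic s (pi_ord w) <->
    one_orbit (edge_prod (@pair_ends n) (pmap (@pair_part n) w)) /\
    ((-1) ^+ (odd #|loops G|))%R = s.
  move=> ow; have [|f Ef sf] := @pi_ord_signed n G w.
    by case: ow => _ Ew e; rewrite Ew.
  rewrite -(edge_ordering_loops ow) -sf; exact: full_cyclic_one_orbit.
have tree := @one_orbit_tree _ _ (unsigned G).
rewrite card_ord in tree.
have {}tree := tree n0 (fun e f g _ _ _ => @unsigned_parallel e f g).
split=> [all1|[/tree all1 Es] w ow]; last first.
  by apply/(key w ow); split=> //; have [U Ew] := edge_ordering_pairs ow; apply: all1.
split; last first.
  (* The parity of the loops is read off from a single ordering, so one has to exist. *)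
  have [w ow] : exists w, edge_ordering G w.
    exists (enum (sedges G)); split; first exact: enum_uniq.
    by move=> e; rewrite mem_enum.
  by have /(key w ow)[] := all1 w ow.
apply/tree => w Uw Ew; have [w' ow <-] := edge_ordering_of_pairs Uw Ew.
by have /(key w' ow)[] := all1 w' ow.
Qed.

End SignedGraphs.

Theorem theorem1p9 (n : nat) (hn : 0 < n) (G : sgraph n) :
  ((forall w : seq (sedge n), edge_ordering G w -> even_ordering w) <->
   (is_tree (unsigned G) /\ ~~ odd #|loops G|)) /\
  ((forall w : seq (sedge n), edge_ordering G w -> odd_ordering w) <->
   (is_tree (unsigned G) /\ odd #|loops G|)).
Proof.
have even := full_cyclic_orderings G hn 1%R.
have odd' := full_cyclic_orderings G hn (-1)%R.
split; [apply: (iff_trans even) | apply: (iff_trans odd')];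
  by case: (odd _); split=> -[].
Qed.
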